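(* Let $n\neq -2,-1,0$ be real, let $\mu=\frac{3n+4}{n+2}$, and let $C$ be a real constant. The point transformation $$x'=\left(x^{\frac{2n+2}{n+2}}+C\right)^{\frac{n+2}{2n+2}},\qquad t'=t,\qquad u'=u\,x^{\frac{2}{n+2}}\left(x^{\frac{2n+2}{n+2}}+C\right)^{-\frac{1}{n+1}}$$ maps the equation $$u_t=\left(u^nu_x\right)_x+\frac{\mu}{x}u^nu_x$$ into itself (that is, into the same equation for $u'(x',t')$).
   Context: Subscripts denote partial derivatives. A point transformation $x'=P(x,t)$, $t'=Q(t)$, $u'=R(x,t,u)$ ''maps an equation $E'$ for $u'(x',t')$ into an equation $E$ for $u(x,t)$'' if: whenever $(x,t)\mapsto(P(x,t),Q(t))$ is a diffeomorphism of an open set $D$ onto an open set $D'$, $u$ is a smooth positive function on $D$, and $u'$ is defined on $D'$ by $u'(P(x,t),Q(t))=R(x,t,u(x,t))$, then $u'$ satisfies $E'$ on $D'$ if and only if $u$ satisfies $E$ on $D$. Here $D$ lies in the region where $x>0$ and $x^{\frac{2n+2}{n+2}}+C>0$, so that all real powers are defined. *)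

(* Defs.v *)
From Stdlib Require Export Reals.
From Coquelicot Require Export Coquelicot.

Open Scope R_scope.

(** Stdlib reals with Coquelicot.  Functions of [(x,t)] are curried; only their
    values on the open set under consideration matter. *)

(** [ex_diff_n f k x t] asks for all iterated partial derivatives of order
    at most [k] at the point, together with their continuity there; on an open
    set, having it for every [k] at every point is being C^infinity. *)
Definition smooth_on (D : R * R -> Prop) (f : R -> R -> R) : Prop :=
  forall (k : nat) (x t : R), D (x, t) -> ex_diff_n f k x t.

Definition diffeomorphism (D D' : R * R -> Prop) (F1 F2 : R -> R -> R) : Prop :=
  open D /\ open D' /\
  smooth_on D F1 /\ smooth_on D F2 /\
  (forall x t, D (x, t) -> D' (F1 x t, F2 x t)) /\
  exists G1 G2 : R -> R -> R,
    smooth_on D' G1 /\ smooth_on D' G2 /\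
    (forall y s, D' (y, s) -> D (G1 y s, G2 y s)) /\
    (forall x t, D (x, t) ->
       G1 (F1 x t) (F2 x t) = x /\ G2 (F1 x t) (F2 x t) = t) /\
    (forall y s, D' (y, s) ->
       F1 (G1 y s) (G2 y s) = y /\ F2 (G1 y s) (G2 y s) = s).

Definition Dx (u : R -> R -> R) (x t : R) : R := Derive (fun y => u y t) x.
Definition Dt (u : R -> R -> R) (x t : R) : R := Derive (fun s => u x s) t.

(** An equation for a function of two variables, as the condition that it
    imposes at each point. *)
Definition equation := (R -> R -> R) -> R -> R -> Prop.

Definition satisfies_on (E : equation) (D : R * R -> Prop) (u : R -> R -> R) : Prop :=
  forall x t, D (x, t) -> E u x t.

(** The transformation [x' = P x t, t' = Q t, u' = U x t u] maps [E'] into [E],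
    on open sets [D] inside [region]. *)
Definition maps_into (region : R * R -> Prop)
    (P : R -> R -> R) (Q : R -> R) (U : R -> R -> R -> R)
    (E' E : equation) : Prop :=
  forall D D' : R * R -> Prop,
    (forall p, D p -> region p) ->
    diffeomorphism D D' P (fun _ t => Q t) ->
  forall u : R -> R -> R,
    smooth_on D u ->
    (forall x t, D (x, t) -> 0 < u x t) ->
  forall u' : R -> R -> R,
    (forall x t, D (x, t) -> u' (P x t) (Q t) = U x t (u x t)) ->
    (satisfies_on E' D' u' <-> satisfies_on E D u).

(** [u_t = (u^n u_x)_x + (mu/x) u^n u_x].  As [Derive] takes an arbitrary value
    where there is no derivative, existence of the derivatives involved is part
    of the equation.  [Rpower] is the real power for a positive base. *)
Definition diffusion_equation (n mu : R) : equation :=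
  fun u x t =>
    let flux := fun y s => Rpower (u y s) n * Dx u y s in
    ex_derive (fun s => u x s) t /\
    ex_derive (fun y => u y t) x /\
    ex_derive (fun y => flux y t) x /\
    Dt u x t = Dx flux x t + mu / x * Rpower (u x t) n * Dx u x t.

(* Main.v *)
Require Import Defs.
From Stdlib Require Import Reals Lra.
From Coquelicot Require Import Coquelicot.
Open Scope R_scope.

(** Put [b = 2 / (n + 2)].  Then [(2n + 2) / (n + 2) = 2 - b], [mu = 3 - b],
    [n b = 2 - 2 b] and [b (n + 1) = 2 - b], and the transformation is
    [y = (x^(2-b) + C)^(1/(2-b))], [w = v x^b y^(-b)] at each fixed time, where
    [v] and [w] are the old and the new unknown.

    The change of variable is linear in the power [2 - b], hence is inverted by
    the same formula with [- C] in place of [C], and [x] is an explicit function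
    of [y] near each point of [D'].  Carrying the equation through this inverse
    gives the differentiability of [w] from that of [v] by the chain rule.

    With [x^(2-b) = y^(2-b) - C], the chain rule yields for the fluxes
    [w^n w_y = (x / y) v^n v_x + b C v^(n+1) y^(b-3)]
    (lemma [flux_pulled_back]).  The factor [y^(b-3) = y^(-mu)] is annihilated
    by the operator [d/dy + mu / y], so the last term contributes only a multiple
    of [v^n v_x]; with [b (n + 1) = 2 - b] everything collects into
    [(d/dy + mu/y) (w^n w_y) = x^b y^(-b) (d/dx + mu/x) (v^n v_x)]
    (lemma [spatial_part_pulled_back]).  The time derivative is multiplied by
    the same positive factor [x^b y^(-b)], as [x] and [y] do not depend on time.
    So at corresponding points one equation holds if and only if the other
    does, and the points of [D'] are exactly the images of those of [D]. *)

(** * Real powers *)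

Lemma Rpower_pos (x c : R) : 0 < Rpower x c.
Proof. apply exp_pos. Qed.

Lemma is_derive_Rpower_comp (f : R -> R) (c x df : R) :
  0 < f x -> is_derive f x df ->
  is_derive (fun y => Rpower (f y) c) x (c * Rpower (f x) c / f x * df).
Proof.
  intros Hf Hdf. unfold Rpower. auto_derive.
  - repeat split; auto. now exists df.
  - replace (Derive (fun y : R => f y) x) with df
      by (symmetry; exact (is_derive_unique f x df Hdf)).
    field. lra.
Qed.

Lemma Rpower_two_minus (x b : R) : 0 < x -> Rpower x (2 - b) = x ^ 2 / Rpower x b.
Proof.
  intros Hx. unfold Rminus, Rdiv.
  replace 2 with (INR 2) at 1 by (simpl; ring).
  rewrite Rpower_plus, Rpower_Ropp, Rpower_pow; trivial.
Qed.

(** * The change of the space variable *)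

(** Translation by [C] in the coordinate [x^a]. *)
Definition shift (a C x : R) : R := Rpower (Rpower x a + C) (/ a).

Lemma shift_pos (a C x : R) : 0 < shift a C x.
Proof. apply Rpower_pos. Qed.

Lemma Rpower_shift (a C x : R) :
  a <> 0 -> 0 < Rpower x a + C ->
  Rpower (shift a C x) a = Rpower x a + C.
Proof.
  intros Ha H. unfold shift. rewrite Rpower_mult.
  replace (/ a * a) with 1 by (field; trivial). now apply Rpower_1.
Qed.

Lemma shift_opp_shift (a C x : R) :
  a <> 0 -> 0 < x -> 0 < Rpower x a + C ->
  shift a (- C) (shift a C x) = x.
Proof.
  intros Ha Hx H. unfold shift at 1. rewrite Rpower_shift by trivial.
  replace (Rpower x a + C + - C) with (Rpower x a) by ring.
  rewrite Rpower_mult. replace (a * / a) with 1 by (field; trivial).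
  now apply Rpower_1.
Qed.

(** Writing [h] for the map, [h' = (x / h)^(a-1)]; the form below has [a]
    as the only exponent, so that for [a = 2 - b] it becomes rational in [x],
    [h] and their [b]-th powers by [Rpower_two_minus]. *)
Lemma is_derive_shift (a C x : R) :
  a <> 0 -> 0 < x -> 0 < Rpower x a + C ->
  is_derive (shift a C) x
    (shift a C x * Rpower x a / (x * Rpower (shift a C x) a)).
Proof.
  intros Ha Hx H. rewrite Rpower_shift by trivial.
  evar_last.
  - apply (is_derive_Rpower_comp (fun y => Rpower y a + C)); [exact H|].
    apply @is_derive_plus; [|apply @is_derive_const].
    apply (is_derive_Rpower_comp (fun y => y)); [exact Hx|].
    apply @is_derive_id.
  - unfold shift, plus, zero, one; simpl. field. repeat split; lra.
Qed.

(** The relation [x^(2-b) = y^(2-b) - C] in terms of [b]-th powers.  It is used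
    to eliminate [C], after which the identities below are rational in [x],
    [y] and their [b]-th powers. *)
Lemma inverse_shift_relation (b C y : R) :
  2 - b <> 0 -> 0 < y -> 0 < Rpower y (2 - b) - C ->
  let x := shift (2 - b) (- C) y in
  x ^ 2 / Rpower x b = y ^ 2 / Rpower y b - C.
Proof.
  intros Ha Hy HC x.
  rewrite <- !Rpower_two_minus by (trivial; apply shift_pos).
  now apply Rpower_shift.
Qed.

Lemma is_derive_inverse_shift (b C y : R) :
  2 - b <> 0 -> 0 < y -> 0 < Rpower y (2 - b) - C ->
  let x := shift (2 - b) (- C) y in
  is_derive (shift (2 - b) (- C)) y (y * Rpower x b / (x * Rpower y b)).
Proof.
  intros Ha Hy HC x. evar_last.
  - now apply is_derive_shift.
  - fold x. assert (Hx : 0 < x) by apply shift_pos.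
    rewrite !Rpower_two_minus by trivial.
    pose proof (Rpower_pos x b). pose proof (Rpower_pos y b).
    field. repeat split; lra.
Qed.

(** * The flux and the spatial part of the equation *)

Definition flux (n : R) (v : R -> R) (x : R) : R := Rpower (v x) n * Derive v x.

Definition spatial_part (n mu : R) (v : R -> R) (x : R) : R :=
  Derive (flux n v) x + mu / x * flux n v x.

Lemma ex_derive_flux (n : R) (v : R -> R) (x : R) :
  0 < v x -> ex_derive v x -> ex_derive (Derive v) x -> ex_derive (flux n v) x.
Proof.
  intros Hp H1 [l H2]. eexists. unfold flux.
  apply @is_derive_mult; [| exact H2 | intros; apply Rmult_comm].
  apply is_derive_Rpower_comp; [exact Hp|]. now apply Derive_correct.
Qed.

(** At [y], the new unknown [w] is expressed by the old unknown [v] at the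
    preimage [x] of [y].  The conditions under which the real powers and the
    derivative of [v] are meaningful are included, so that one [locally]
    hypothesis carries everything that is differentiated. *)
Definition pulled_back (b C : R) (v w : R -> R) (y : R) : Prop :=
  let x := shift (2 - b) (- C) y in
  0 < y /\ 0 < Rpower y (2 - b) - C /\
  0 < v x /\ ex_derive v x /\
  w y = v x * (Rpower x b * Rpower y (- b)).

Lemma is_derive_pulled_back (b C : R) (v w : R -> R) (y : R) :
  2 - b <> 0 -> locally y (pulled_back b C v w) ->
  let x := shift (2 - b) (- C) y in
  is_derive w y
    ((Derive v x + b * v x / x) * (y * Rpower x b ^ 2 / (x * Rpower y b ^ 2))
     - b * v x * Rpower x b / (y * Rpower y b)).
Proof.
  intros Ha Hloc x.
  destruct (locally_singleton _ _ Hloc) as (Hy & HC & _ & Hv & _). fold x in Hv.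
  assert (Hx : 0 < x) by apply shift_pos.
  pose proof (is_derive_inverse_shift b C y Ha Hy HC) as Hh.
  cbv zeta in Hh; fold x in Hh.
  apply (is_derive_ext_loc
    (fun z => v (shift (2 - b) (- C) z)
              * (Rpower (shift (2 - b) (- C) z) b * Rpower z (- b)))).
  { refine (filter_imp _ _ _ Hloc). intros z (_ & _ & _ & _ & E). now symmetry. }
  evar_last.
  - apply @is_derive_mult; [| |intros; apply Rmult_comm].
    + apply @is_derive_comp; [apply Derive_correct, Hv | exact Hh].
    + apply @is_derive_mult; [| |intros; apply Rmult_comm].
      * apply is_derive_Rpower_comp; [exact Hx | exact Hh].
      * apply (is_derive_Rpower_comp (fun z => z)); [exact Hy|].
        apply @is_derive_id.
  - unfold plus, mult, scal, one; simpl. unfold mult; simpl. fold x.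
    rewrite Rpower_Ropp.
    pose proof (Rpower_pos x b). pose proof (Rpower_pos y b).
    field. repeat split; lra.
Qed.

(** The factor of [v^n v_x] is [x / y] because [w^n] contributes
    [(x / y)^(n b) = (x / y)^(2-2b)] and [w_y] contributes [(x / y)^(2b-1)].
    Differentiating [x^b y^(-b)] produces
    [(b / y) (1 - x^(2-b) y^(b-2)) v^(n+1)], which is [b C y^(b-3) v^(n+1)]. *)
Lemma flux_pulled_back (n b C : R) (v w : R -> R) (y : R) :
  2 - b <> 0 -> n * b = 2 - 2 * b -> locally y (pulled_back b C v w) ->
  let x := shift (2 - b) (- C) y in
  flux n w y = flux n v x * (x / y)
               + b * C * (Rpower (v x) (n + 1) * (Rpower y b / y ^ 3)).
Proof.
  intros Ha Hnb Hloc x.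
  destruct (locally_singleton _ _ Hloc) as (Hy & HC & Hp & _ & Hw).
  cbv zeta in Hw; fold x in Hw, Hp.
  assert (Hx : 0 < x) by apply shift_pos.
  pose proof (inverse_shift_relation b C y Ha Hy HC) as Hsq. cbv zeta in Hsq; fold x in Hsq.
  pose proof (Rpower_pos x b) as HA. pose proof (Rpower_pos y b) as HB.
  unfold flux.
  rewrite (is_derive_unique _ _ _ (is_derive_pulled_back b C v w y Ha Hloc)).
  fold x. rewrite Hw.
  rewrite <- !Rpower_mult_distr, !Rpower_mult;
    try apply Rmult_lt_0_compat; try apply Rpower_pos; trivial.
  rewrite Rpower_plus, Rpower_1 by trivial.
  replace (b * n) with ((2 - b) + - b) by lra.
  replace (- b * n) with (- ((2 - b) + - b)) by lra.
  rewrite Rpower_Ropp, !Rpower_plus, !Rpower_Ropp, !Rpower_two_minus by trivial.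
  replace C with (y ^ 2 / Rpower y b - x ^ 2 / Rpower x b) by lra.
  field. repeat split; lra.
Qed.

(** The term [b C v^(n+1) y^(b-3)] of the new flux is differentiated as a
    product: the derivative of [y^(b-3)] cancels against [mu / y] times the
    term, since [mu = 3 - b], and [b (n + 1) v^n v_x = (2 - b) v^n v_x] remains
    from the derivative of [v^(n+1)]. *)
Lemma spatial_part_pulled_back (n b C : R) (v w : R -> R) (y : R) :
  2 - b <> 0 -> n * b = 2 - 2 * b -> locally y (pulled_back b C v w) ->
  let x := shift (2 - b) (- C) y in
  ex_derive (Derive v) x ->
  ex_derive (flux n w) y /\
  spatial_part n (3 - b) w y =
    Rpower x b * Rpower y (- b) * spatial_part n (3 - b) v x.
Proof.
  intros Ha Hnb Hloc x Hv2.
  destruct (locally_singleton _ _ Hloc) as (Hy & HC & Hp & Hv & _).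
  cbv zeta in Hv; fold x in Hv, Hp.
  assert (Hx : 0 < x) by apply shift_pos.
  pose proof (inverse_shift_relation b C y Ha Hy HC) as Hsq. cbv zeta in Hsq; fold x in Hsq.
  pose proof (is_derive_inverse_shift b C y Ha Hy HC) as Hh.
  cbv zeta in Hh; fold x in Hh.
  pose proof (Rpower_pos x b) as HA. pose proof (Rpower_pos y b) as HB.
  pose proof (Derive_correct _ _ (ex_derive_flux n v x Hp Hv Hv2)) as Hf.
  set (h := shift (2 - b) (- C)) in *.
  assert (HD : is_derive (flux n w) y
    (Derive (flux n v) x * Rpower x b / Rpower y b
     + flux n v x * (Rpower x b / (x * Rpower y b) - x / y ^ 2)
     + b * C * ((n + 1) * flux n v x * Rpower x b / (x * y ^ 2)
                + (b - 3) * Rpower (v x) (n + 1) * Rpower y b / y ^ 4))).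
  { apply (is_derive_ext_loc
      (fun z => flux n v (h z) * (h z / z)
        + b * C * (Rpower (v (h z)) (n + 1) * (Rpower z b / z ^ 3)))).
    { refine (filter_imp _ _ _ (locally_locally _ _ Hloc)). intros z Hz. symmetry.
      now apply flux_pulled_back. }
    assert (Hpow : is_derive (fun z => Rpower z b) y (b * Rpower y b / y * 1)).
    { apply (is_derive_Rpower_comp (fun z => z)); [exact Hy|].
      apply @is_derive_id. }
    evar_last.
    - apply @is_derive_plus.
      + apply @is_derive_mult; [| |intros; apply Rmult_comm].
        * apply @is_derive_comp; [exact Hf | exact Hh].
        * apply is_derive_div; [exact Hh | apply @is_derive_id | lra].
      + apply is_derive_scal.
        apply @is_derive_mult; [| |intros; apply Rmult_comm].
        * apply is_derive_Rpower_comp; [exact Hp|].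
          apply @is_derive_comp; [apply Derive_correct, Hv | exact Hh].
        * apply is_derive_div; [exact Hpow | | apply pow_nonzero; lra].
          apply is_derive_pow, @is_derive_id.
    - unfold plus, mult, scal, one; simpl. unfold mult; simpl. fold x.
      replace (h y) with x by reflexivity. unfold flux.
      rewrite !Rpower_plus, !Rpower_1 by trivial.
      field. repeat split; lra. }
  split; [eexists; exact HD|].
  unfold spatial_part. rewrite (is_derive_unique _ _ _ HD).
  rewrite (flux_pulled_back n b C v w y Ha Hnb Hloc). fold h; fold x.
  rewrite Rpower_Ropp.
  (* [b (n + 1) = 2 - b] removes [n] before [C] is eliminated. *)
  replace (b * C * ((n + 1) * flux n v x * Rpower x b / (x * y ^ 2)
                + (b - 3) * Rpower (v x) (n + 1) * Rpower y b / y ^ 4))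
    with (C * ((2 - b) * flux n v x * Rpower x b / (x * y ^ 2)
                + b * (b - 3) * Rpower (v x) (n + 1) * Rpower y b / y ^ 4))
    by (replace (2 - b) with (b * (n + 1)) by lra; field; lra).
  replace C with (y ^ 2 / Rpower y b - x ^ 2 / Rpower x b) by lra.
  field. repeat split; lra.
Qed.

(** * The transformation of the equation *)

Lemma locally_slices (D : R * R -> Prop) (x t : R) :
  open D -> D (x, t) ->
  locally x (fun y => D (y, t)) /\ locally t (fun s => D (x, s)).
Proof.
  intros HD H. destruct (HD _ H) as [e He].
  split; exists e; intros z Hz; apply He; split; simpl; trivial; apply ball_center.
Qed.

Lemma ex_derive_time_scaled (f g : R -> R) (c t : R) :
  locally t (fun s => g s = f s * c) -> ex_derive f t ->
  ex_derive g t /\ Derive g t = c * Derive f t.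
Proof.
  intros Hloc Hf.
  assert (H : is_derive g t (c * Derive f t)).
  { apply (is_derive_ext_loc (fun s => c * f s)).
    - refine (filter_imp _ _ _ Hloc). intros s E. rewrite E. apply Rmult_comm.
    - apply is_derive_scal. now apply Derive_correct. }
  split; [eexists; exact H | now apply is_derive_unique].
Qed.

Theorem mainTheorem4 :
  forall n mu C : R,
    n <> -2 -> n <> -1 -> n <> 0 ->
    mu = (3 * n + 4) / (n + 2) ->
    maps_into
      (fun p => 0 < fst p /\ 0 < Rpower (fst p) ((2 * n + 2) / (n + 2)) + C)
      (fun x _ => Rpower (Rpower x ((2 * n + 2) / (n + 2)) + C)
                         ((n + 2) / (2 * n + 2)))
      (fun t => t)
      (fun x _ u => u * Rpower x (2 / (n + 2))
                      * Rpower (Rpower x ((2 * n + 2) / (n + 2)) + C)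
                               (- (1 / (n + 1))))
      (diffusion_equation n mu)
      (diffusion_equation n mu).
Proof.
  intros n mu C Hn2 Hn1 _ Hmu D D' Hreg Hdiff u Hsm Hpos u' Hu'.
  assert (Hd1 : n + 2 <> 0) by lra. assert (Hd2 : n + 1 <> 0) by lra.
  assert (Hd3 : 2 * n + 2 <> 0) by lra.
  set (b := 2 / (n + 2)) in *.
  assert (Ea : (2 * n + 2) / (n + 2) = 2 - b) by (unfold b; field; trivial).
  assert (Ei : (n + 2) / (2 * n + 2) = / (2 - b))
    by (rewrite <- Ea; field; split; trivial).
  assert (Em : mu = 3 - b) by (rewrite Hmu; unfold b; field; trivial).
  assert (Hnb : n * b = 2 - 2 * b) by (unfold b; field; trivial).
  assert (Ha : 2 - b <> 0).
  { rewrite <- Ea. intros E. apply Rmult_integral in E.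
    destruct E as [E|E]; [lra|]. now apply Rinv_neq_0_compat in E. }
  assert (Ee : - (1 / (n + 1)) = / (2 - b) * - b).
  { rewrite <- Ei. unfold b. field. repeat split; trivial. }
  clear Hmu. subst mu. rewrite Ea in Hreg, Hdiff. rewrite Ei in Hdiff. rewrite Ea, Ei, Ee in Hu'.
  destruct Hdiff as (HoD & HoD' & _ & _ & HF & G1 & G2 & _ & _ & HG & _ & HFG).
  assert (HU : forall x t, D (x, t) ->
    u' (shift (2 - b) C x) t
    = u x t * (Rpower x b * Rpower (shift (2 - b) C x) (- b))).
  { intros x t H. unfold shift. rewrite Hu' by exact H.
    rewrite Rpower_mult. ring. }
  (* The second component of the map is the identity, so each point of [D']
     is the image of a point of [D] at the same time. *)
  assert (Honto : forall y t, D' (y, t) ->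
    exists x, D (x, t) /\ shift (2 - b) C x = y).
  { intros y t H. destruct (HFG y t H) as [E1 E2].
    pose proof (HG y t H) as HD. rewrite E2 in HD. now exists (G1 y t). }
  assert (Hinv : forall x t, D (x, t) ->
    shift (2 - b) (- C) (shift (2 - b) C x) = x).
  { intros x t H. destruct (Hreg _ H). now apply shift_opp_shift. }
  assert (Hpt : forall x t, D (x, t) ->
    diffusion_equation n (3 - b) u' (shift (2 - b) C x) t
    <-> diffusion_equation n (3 - b) u x t).
  { intros x t H. set (y := shift (2 - b) C x).
    assert (Hxy : shift (2 - b) (- C) y = x) by now apply (Hinv x t).
    pose proof (HF x t H : D' (y, t)) as H'.
    assert (Hreg1 : forall x s, D (x, s) ->
      ex_derive (fun z => u z s) x /\ ex_derive (fun r => u x r) s /\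
      ex_derive (Derive (fun z => u z s)) x).
    { intros x0 s0 H0. destruct (Hsm 2%nat x0 s0 H0) as (_ & A1 & A2 & (_ & A3 & _) & _).
      repeat split; trivial. }
    assert (Hloc : locally y (pulled_back b C (fun z => u z t) (fun z => u' z t))).
    { destruct (locally_slices D' y t HoD' H') as [L _].
      refine (filter_imp _ _ _ L). intros z Hz.
      destruct (Honto z t Hz) as (x0 & Hx0 & <-).
      destruct (Hreg _ Hx0) as [P1 P2]; cbn [fst] in P1, P2.
      unfold pulled_back. rewrite (Hinv x0 t Hx0), Rpower_shift by trivial.
      pose proof (Rpower_pos x0 (2 - b)).
      destruct (Hreg1 _ _ Hx0) as (E & _).
      repeat split; trivial; [apply shift_pos | lra | now apply Hpos | now apply HU]. }
    destruct (Hreg1 x t H) as (Ex & Et & Exx).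
    destruct (spatial_part_pulled_back n b C (fun z => u z t) (fun z => u' z t) y)
      as [Sx Seq]; trivial; rewrite ?Hxy in *; trivial.
    pose proof (is_derive_pulled_back b C _ _ y Ha Hloc) as Sw.
    pose proof (ex_derive_flux n (fun z => u z t) x (Hpos x t H) Ex Exx) as Sf.
    assert (Hc : Rpower x b * Rpower y (- b) <> 0).
    { apply Rmult_integral_contrapositive; split; apply Rgt_not_eq, Rpower_pos. }
    destruct (ex_derive_time_scaled (fun s => u x s) (fun s => u' y s)
                (Rpower x b * Rpower y (- b)) t) as [Tx Teq]; trivial.
    { destruct (locally_slices D x t HoD H) as [_ L].
      refine (filter_imp _ _ _ L). intros s Hs. now apply HU. }
    unfold spatial_part, flux in *. unfold diffusion_equation, Dt, Defs.Dx in *.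
    rewrite !Rmult_assoc in *.
    split; intros (_ & _ & _ & E).
    - repeat split; trivial. cbv beta in *.
      rewrite Teq, <- Rmult_assoc, Seq, <- Rmult_assoc in E.
      now apply Rmult_eq_reg_l in E.
    - repeat split; trivial.
      + eexists; exact Sw.
      + cbv beta in *. rewrite Teq, Seq, E. ring. }
  split; intros HE.
  - intros x t H. apply Hpt; trivial. apply HE. now apply HF.
  - intros y t H. destruct (Honto y t H) as (x & Hx & <-).
    apply Hpt; trivial. now apply HE.
Qed.
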